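(* There exists an absolute constant $C>0$ such that the following holds. Let $m,n,d$ be positive integers, let $\alpha\in(0,1]$, and let $f$ be the leaky ReLU network $f(W,x)=\sum_{j=1}^{2m}(-1)^j\sigma(\langle w_j,x\rangle)$ with $\sigma(z)=\max(z,\alpha z)$, where $w_j$ is the $j$-th row of $W\in\mathbb{R}^{2m\times d}$. Let $(X,\hat y)\in\mathbb{R}^{n\times d}\times\{\pm1\}^n$ be any linearly separable dataset, where $X$ has rows $x_1,\dots,x_n$, and let $w^*$ be its max-margin linear classifier. Suppose the step size satisfies $0<\eta\le \frac{1}{mn\max_{i\in[n]}\|x_i\|^2}$ and the initialization $W^{(0)}\in\mathbb{R}^{2m\times d}$ satisfies $\|w^{(0)}_j\|\le\lambda$ for all $j\in[2m]$, where $\lambda\le\frac{\sqrt{\alpha}}{m\min_{i\in[n]}\|x_i\|}$. Then gradient descent on the hinge loss converges after finitely many iterations: there is $T$ with $$T\le \frac{C\|w^*\|^2}{\eta\alpha^2 m}$$ such that $W^{(t)}=W^{(T)}$ for all $t\ge T$. Furthermore, the algorithm $\mathcal{A}_{GD}$ that returns $W=W^{(T)}$ is approximately margin maximizing on $f$, with $$|\mathcal{A}_{GD}|\le\frac{C}{\alpha\sqrt m};$$ that is, for every such linearly separable $(X,\hat y)$, $\eta$ and $W^{(0)}$, the output $W$ satisfies $\hat y_i f(W,x_i)\ge 1$ for all $i\in[n]$ and $\|W\|_F\le \frac{C}{\alpha\sqrt m}\|w^*\|$.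
   Context: $\|\cdot\|$ is the Euclidean norm of a vector and $\|\cdot\|_F$ the Frobenius norm. $(X,\hat y)$ is linearly separable if there is $w\in\mathbb{R}^d$ with $\hat y_i\langle w,x_i\rangle\ge1$ for all $i\in[n]$; the max-margin linear classifier $w^*$ is the unique minimizer of $\|w\|$ subject to $\hat y_i\langle w,x_i\rangle\ge 1$ for all $i\in[n]$. Subgradient convention: $\dot\sigma(z)=1$ if $z\ge0$ and $\dot\sigma(z)=\alpha$ if $z<0$. The training loss is $L(W,X,\hat y)=\sum_{i=1}^n\max\{0,1-\hat y_if(W,x_i)\}$. Gradient descent with step size $\eta$ and initialization $W^{(0)}$ is, for $t\ge1$ and $j\in[2m]$, $$w_j^{(t)}=w_j^{(t-1)}+\eta(-1)^j\sum_{i\in\mathcal F^{(t-1)}}\hat y_i\,\dot\sigma(\langle w_j^{(t-1)},x_i\rangle)\,x_i,\qquad \mathcal F^{(t)}=\{i\in[n]:\hat y_if(W^{(t)},x_i)<1\}.$$ An algorithm $\mathcal A$ mapping datasets to parameters of $f$ is approximately margin maximizing on $f$ with factor $M>0$ if for every linearly separable $(X,\hat y)$ one has $\hat y_if(\mathcal A(X,\hat y),x_i)\ge1$ for all $i$ and $\|\mathcal A(X,\hat y)\|_F\le M\|w^*\|$; $|\mathcal A|$ is the infimum of such $M$. *)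

(* Defs.v *)
From HB Require Import structures.
From mathcomp Require Import all_boot all_order all_algebra.
From mathcomp Require Import all_classical all_reals all_analysis.

Set Implicit Arguments.
Unset Strict Implicit.
Unset Printing Implicit Defensive.

Import Order.TTheory GRing.Theory Num.Theory.

Local Open Scope classical_set_scope.
Local Open Scope ring_scope.

Definition dot (R : realType) (d : nat) (u v : 'rV[R]_d) : R :=
  \sum_(k < d) u 0 k * v 0 k.

(* Frobenius norm; on row vectors this is the Euclidean norm.  The library norm
   `|A| on matrices is the max norm. *)
Definition l2norm (R : realType) (p q : nat) (A : 'M[R]_(p, q)) : R :=
  Num.sqrt (\sum_(i < p) \sum_(j < q) A i j ^+ 2).

(* The unit of index j : 'I_(m.*2) is the paper's unit j + 1 in {1, ..., 2m}. *)
Definition unit_sign (R : realType) (m : nat) (j : 'I_(m.*2)) : R :=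
  (-1) ^+ j.+1.

Definition leaky_relu (R : realType) (alpha z : R) : R :=
  Num.max z (alpha * z).

Definition leaky_relu_subgrad (R : realType) (alpha z : R) : R :=
  if 0 <= z then 1 else alpha.

Definition network (R : realType) (m d : nat) (alpha : R)
    (W : 'M[R]_(m.*2, d)) (x : 'rV[R]_d) : R :=
  \sum_(j < m.*2) unit_sign R j * leaky_relu alpha (dot (row j W) x).

Definition is_labeling (R : realType) (n : nat) (y : 'I_n -> R) : Prop :=
  forall i, y i = 1 \/ y i = -1.

Definition linear_margin_ge1 (R : realType) (n d : nat) (X : 'M[R]_(n, d))
    (y : 'I_n -> R) (w : 'rV[R]_d) : Prop :=
  forall i, 1 <= y i * dot w (row i X).

Definition linearly_separable (R : realType) (n d : nat) (X : 'M[R]_(n, d))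
    (y : 'I_n -> R) : Prop :=
  exists w, linear_margin_ge1 X y w.

(* On a separable dataset a minimizer exists and is unique (minimal-norm point
   of a nonempty closed convex set). *)
Definition is_max_margin (R : realType) (n d : nat) (X : 'M[R]_(n, d))
    (y : 'I_n -> R) (w : 'rV[R]_d) : Prop :=
  linear_margin_ge1 X y w /\
  forall w', linear_margin_ge1 X y w' -> l2norm w <= l2norm w'.

(* max_i |x_i| and min_i |x_i|: for 0 < n the sup and inf are attained. *)
Definition max_row_norm (R : realType) (n d : nat) (X : 'M[R]_(n, d)) : R :=
  sup (range (fun i : 'I_n => l2norm (row i X))).

Definition min_row_norm (R : realType) (n d : nat) (X : 'M[R]_(n, d)) : R :=
  inf (range (fun i : 'I_n => l2norm (row i X))).

Definition hinge_loss (R : realType) (m n d : nat) (alpha : R)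
    (X : 'M[R]_(n, d)) (y : 'I_n -> R) (W : 'M[R]_(m.*2, d)) : R :=
  \sum_(i < n) Num.max 0 (1 - y i * network alpha W (row i X)).

(* Gradient step on hinge_loss, with subgradient 0 of max(0, .) at 0 and
   leaky_relu_subgrad for the activation. *)
Definition gd_step (R : realType) (m n d : nat) (alpha eta : R)
    (X : 'M[R]_(n, d)) (y : 'I_n -> R) (W : 'M[R]_(m.*2, d)) :
    'M[R]_(m.*2, d) :=
  \matrix_(j < m.*2)
    (row j W + (eta * unit_sign R j) *:
      \sum_(i < n | y i * network alpha W (row i X) < 1)
        (y i * leaky_relu_subgrad alpha (dot (row j W) (row i X))) *: row i X).

Definition gd (R : realType) (m n d : nat) (alpha eta : R)
    (X : 'M[R]_(n, d)) (y : 'I_n -> R) (W0 : 'M[R]_(m.*2, d)) (t : nat) :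
    'M[R]_(m.*2, d) :=
  iter t (gd_step alpha eta X y) W0.

Definition step_size_ok (R : realType) (m n d : nat) (X : 'M[R]_(n, d))
    (eta : R) : Prop :=
  0 < eta /\ eta <= 1 / (m%:R * n%:R * max_row_norm X ^+ 2).

Definition init_ok (R : realType) (m n d : nat) (alpha : R)
    (X : 'M[R]_(n, d)) (lambda : R) (W0 : 'M[R]_(m.*2, d)) : Prop :=
  lambda <= Num.sqrt alpha / (m%:R * min_row_norm X) /\
  forall j, l2norm (row j W0) <= lambda.

Definition algorithm (R : realType) (m d : nat) : Type :=
  forall n : nat, 'M[R]_(n, d) -> ('I_n -> R) -> 'M[R]_(m.*2, d).

Definition approx_margin_maximizing (R : realType) (m d : nat) (alpha : R)
    (A : algorithm R m d) (M : R) : Prop :=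
  0 < M /\
  forall (n : nat) (X : 'M[R]_(n, d)) (y : 'I_n -> R) (wstar : 'rV[R]_d),
    (0 < n)%N -> is_labeling y ->
    linearly_separable X y -> is_max_margin X y wstar ->
    (forall i, 1 <= y i * network alpha (A n X y) (row i X)) /\
    l2norm (A n X y) <= M * l2norm wstar.

(* |A|, with value +oo when A has no factor. *)
Definition margin_factor (R : realType) (m d : nat) (alpha : R)
    (A : algorithm R m d) : \bar R :=
  ereal_inf [set M%:E | M in [set M : R | approx_margin_maximizing alpha A M]].

(* The eventual value of an eventually constant sequence; W 0 if there is
   none. *)
Definition final_iterate (T : choiceType) (W : nat -> T) : T :=
  xget (W 0%N) [set V | exists T0, forall t, (T0 <= t)%N -> W t = V].

(* The step size and the initialization may depend on the dataset. *)
Definition gd_algorithm (R : realType) (m d : nat) (alpha : R)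
    (eta : forall n : nat, 'M[R]_(n, d) -> ('I_n -> R) -> R)
    (W0 : algorithm R m d) : algorithm R m d :=
  fun n X y => final_iterate (gd alpha (eta n X y) X y (W0 n X y)).

(* Main.v *)
(* The perceptron argument.  Let F be the set of margin violators and let
   S = eta * (sum of |F| over all steps).  As <x_i, w*> y_i >= 1 and the slopes
   are at least alpha, the alignment sum_j (+-1) <w_j, w*> has grown by at least
   2 m alpha S.  Homogeneity, sigma'(z) z = sigma(z), shows that |W|_F^2 has
   grown by at most 4 S.  Cauchy-Schwarz between W and the matrix with rows
   +-w* then forces S <= (9/2) |w*|^2 / (m alpha^2), the contribution of W^(0)
   being controlled by lambda <= sqrt(alpha) |w*| / m. *)

Require Import Defs.
From HB Require Import structures.
From mathcomp Require Import all_boot all_order all_algebra.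
From mathcomp Require Import all_classical all_reals all_analysis.
From mathcomp Require Import ring lra.

Set Implicit Arguments.
Unset Strict Implicit.
Unset Printing Implicit Defensive.

Import Order.TTheory GRing.Theory Num.Theory.

Local Open Scope ring_scope.

(** * Constant sums, inner products and Euclidean norms *)

Lemma sum_const_card (R : realType) (I : finType) (P : pred I) (b : R) :
  \sum_(i | P i) b = #|P|%:R * b.
Proof. by rewrite (eq_bigl (mem P)) // sumr_const mulr_natl. Qed.

Lemma sum_const_units (R : realType) (m : nat) (b : R) :
  \sum_(j < m.*2) b = 2 * m%:R * b.
Proof. by rewrite sumr_const card_ord -muln2 mulnC -natrM mulr_natl. Qed.

Section Dot.
Variables (R : realType) (d : nat).
Implicit Types u v w : 'rV[R]_d.

Lemma dotC u v : dot u v = dot v u.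
Proof. by apply: eq_bigr => k _; rewrite mulrC. Qed.

Lemma dotDl u v w : dot (u + v) w = dot u w + dot v w.
Proof. by rewrite -big_split /=; apply: eq_bigr => k _; rewrite !mxE mulrDl. Qed.

Lemma dotZl a u v : dot (a *: u) v = a * dot u v.
Proof. by rewrite /dot mulr_sumr; apply: eq_bigr => k _; rewrite !mxE mulrA. Qed.

Lemma dotDr u v w : dot w (u + v) = dot w u + dot w v.
Proof. by rewrite dotC dotDl !(dotC _ w). Qed.

Lemma dotZr a u v : dot u (a *: v) = a * dot u v.
Proof. by rewrite dotC dotZl dotC. Qed.

Lemma dot_suml (I : finType) (P : pred I) (F : I -> 'rV[R]_d) w :
  dot (\sum_(i | P i) F i) w = \sum_(i | P i) dot (F i) w.
Proof.
apply: (big_morph (fun u => dot u w)) => [u v|]; first exact: dotDl.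
by rewrite /dot big1 // => k _; rewrite mxE mul0r.
Qed.

Lemma dot_sumr (I : finType) (P : pred I) (F : I -> 'rV[R]_d) w :
  dot w (\sum_(i | P i) F i) = \sum_(i | P i) dot w (F i).
Proof. by rewrite dotC dot_suml; apply: eq_bigr => i _; rewrite dotC. Qed.

Lemma dot_ge0 u : 0 <= dot u u.
Proof. by apply: sumr_ge0 => k _; rewrite -expr2 sqr_ge0. Qed.

(** Expand [c^-1 * |c u - v|^2 >= 0]. The free weight [c] is what later allows the norm of the
    iterate to be charged to only a part of its alignment. *)
Lemma dot_young (c : R) u v : 0 < c ->
  2 * dot u v <= c * dot u u + c^-1 * dot v v.
Proof.
move=> c0; have c'0 : 0 <= c^-1 by rewrite invr_ge0 ltW.
have := mulr_ge0 c'0 (dot_ge0 (c *: u + (-1) *: v)).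
rewrite !(dotDl, dotDr, dotZl, dotZr) (dotC v u) => h; rewrite -subr_ge0.
by apply: (le_trans h); rewrite le_eqVlt; apply/orP; left; apply/eqP; field; lra.
Qed.

(** The square is a double sum of [#|P|^2] inner products, and Young's inequality with weight 1
    bounds each by [b]. *)
Lemma dot_sum_le (I : finType) (P : pred I) (F : I -> 'rV[R]_d) (b : R) :
  (forall i, P i -> dot (F i) (F i) <= b) ->
  dot (\sum_(i | P i) F i) (\sum_(i | P i) F i) <= #|P|%:R ^+ 2 * b.
Proof.
move=> Fb; rewrite dot_suml.
apply: (@le_trans _ _ (\sum_(i | P i) #|P|%:R * b)); last first.
  by rewrite sum_const_card expr2 mulrA.
apply: ler_sum => i Pi; rewrite dot_sumr -sum_const_card.
apply: ler_sum => j Pj.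
by have := dot_young (F i) (F j) ltr01; have := Fb _ Pi; have := Fb _ Pj; lra.
Qed.

Lemma l2norm_ge0 p q (A : 'M[R]_(p, q)) : 0 <= l2norm A.
Proof. exact: sqrtr_ge0. Qed.

Lemma sqr_l2norm p (A : 'M[R]_(p, d)) :
  l2norm A ^+ 2 = \sum_(j < p) dot (row j A) (row j A).
Proof.
rewrite sqr_sqrtr; last by do 2!apply: sumr_ge0 => ? _; rewrite sqr_ge0.
by apply: eq_bigr => i _; apply: eq_bigr => j _; rewrite !mxE expr2.
Qed.

Lemma sqr_l2norm_row u : l2norm u ^+ 2 = dot u u.
Proof. by rewrite sqr_l2norm big_ord1 row_id. Qed.

Lemma dot_l2norm0 u v : l2norm u = 0 -> dot u v = 0.
Proof.
move=> u0; have /eqP : dot u u = 0 by rewrite -sqr_l2norm_row u0 expr0n.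
rewrite psumr_eq0 => [/allP uk|k _]; last by rewrite -expr2 sqr_ge0.
rewrite /dot big1 // => k _; have := uk k (mem_index_enum k).
by rewrite -expr2 sqrf_eq0 => /eqP ->; rewrite mul0r.
Qed.

(** The weight [|v| / |u|] makes both terms of Young's inequality equal to [|u| |v|]. Zero norms are
    treated first, because the weight must be positive. *)
Lemma cauchy_schwarz u v : dot u v <= l2norm u * l2norm v.
Proof.
have [u0|u_neq0] := eqVneq (l2norm u) 0; 
  first by rewrite dot_l2norm0 // u0 mul0r.
have [v0|v_neq0] := eqVneq (l2norm v) 0.
  by rewrite dotC dot_l2norm0 // v0 mulr0.
have u_gt0 : 0 < l2norm u by rewrite lt_def u_neq0 l2norm_ge0.
have v_gt0 : 0 < l2norm v by rewrite lt_def v_neq0 l2norm_ge0.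
have := dot_young u v (divr_gt0 v_gt0 u_gt0); rewrite -!sqr_l2norm_row.
have -> : l2norm v / l2norm u * l2norm u ^+ 2
    + (l2norm v / l2norm u)^-1 * l2norm v ^+ 2 = 2 * (l2norm u * l2norm v).
  by field; rewrite u_neq0.
lra.
Qed.

End Dot.

Lemma row_norm_le_max (R : realType) (n d : nat) (X : 'M[R]_(n, d)) i :
  l2norm (row i X) <= max_row_norm X.
Proof.
apply: ub_le_sup; last by exists i.
(* The supremum dominates its elements only once the set is known to be bounded; the sum of all row
   norms is a convenient bound. *)
exists (\sum_i l2norm (row i X)) => _ [k _ <-].
by rewrite (bigD1 k) //= lerDl sumr_ge0 // => l _; exact: l2norm_ge0.
Qed.

(** * Slopes of the activation and signs of the units *)

Section Activation.
Variables (R : realType) (alpha : R).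
Hypotheses (alpha_gt0 : 0 < alpha) (alpha_le1 : alpha <= 1).

Lemma subgrad_ge z : alpha <= leaky_relu_subgrad alpha z.
Proof. by rewrite /leaky_relu_subgrad; case: ifP. Qed.

Lemma subgrad_le1 z : leaky_relu_subgrad alpha z <= 1.
Proof. by rewrite /leaky_relu_subgrad; case: ifP. Qed.

Lemma subgradM z : leaky_relu_subgrad alpha z * z = leaky_relu alpha z.
Proof.
rewrite /leaky_relu_subgrad /leaky_relu; case: leP => [z0|z0].
  by rewrite mul1r max_l // ler_piMl.
by rewrite max_r // ler_niMl // ltW.
Qed.

End Activation.

Lemma unit_sign_sqr (R : realType) m (j : 'I_(m.*2)) :
  unit_sign R j * unit_sign R j = 1.
Proof. by rewrite -expr2 /unit_sign sqrr_sign. Qed.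

(** * Effect of one gradient step on alignment and norm *)

Section GradientDescent.
Variables (R : realType) (m n d : nat) (alpha eta : R).
Variables (X : 'M[R]_(n, d)) (y : 'I_n -> R) (wstar : 'rV[R]_d).
Hypotheses (m_gt0 : (0 < m)%N) (n_gt0 : (0 < n)%N).
Hypotheses (alpha_gt0 : 0 < alpha) (alpha_le1 : alpha <= 1).
Hypotheses (y_label : is_labeling y) (wstar_margin : linear_margin_ge1 X y wstar).
Hypothesis eta_ok : step_size_ok m X eta.

Definition violators (W : 'M[R]_(m.*2, d)) : pred 'I_n :=
  fun i => y i * network alpha W (row i X) < 1.

Definition alignment (W : 'M[R]_(m.*2, d)) : R :=
  \sum_(j < m.*2) unit_sign R j * dot (row j W) wstar.

Let eta_gt0 : 0 < eta. Proof. by case: eta_ok. Qed.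

Lemma sqr_label i : y i * y i = 1.
Proof. by case: (y_label i) => ->; rewrite ?mulr1 // mulrNN mulr1. Qed.

(** Cauchy-Schwarz for [wstar] and [y i *: row i X], whose norm is that of the sample. Hence neither
    norm vanishes, and [1 / |wstar|] bounds every sample norm from below. *)
Lemma max_margin_row_norm i : 1 <= l2norm wstar * l2norm (row i X).
Proof.
apply: (le_trans (wstar_margin i)); rewrite -dotZr.
apply: (le_trans (cauchy_schwarz _ _)).
suff -> : l2norm (y i *: row i X) = l2norm (row i X) by [].
apply/eqP; rewrite -(@eqrXn2 _ 2) ?l2norm_ge0 // !sqr_l2norm_row dotZl dotZr.
by rewrite mulrA sqr_label mul1r.
Qed.

Lemma max_margin_norm_gt0 : 0 < l2norm wstar.
Proof.
rewrite lt_def l2norm_ge0 andbT; apply/eqP => w0.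
by have := max_margin_row_norm (Ordinal n_gt0); rewrite w0 mul0r ler10.
Qed.

(** Since [min_row_norm X] is at least [1 / |wstar|], the condition on [lambda] gives
    [lambda <= sqrt alpha * |wstar| / m]. *)
Lemma init_row_norm lambda (W0 : 'M[R]_(m.*2, d)) :
  init_ok alpha X lambda W0 -> forall j,
  dot (row j W0) (row j W0) <= alpha * l2norm wstar ^+ 2 / m%:R ^+ 2.
Proof.
move=> [lambda_le W0_le] j.
have w0 := max_margin_norm_gt0; have m0 : (0 : R) < m%:R by rewrite ltr0n.
have min_ge : (l2norm wstar)^-1 <= min_row_norm X.
  apply: lb_le_inf; first by exists (l2norm (row (Ordinal n_gt0) X));
    exists (Ordinal n_gt0).
  move=> _ [i _ <-]; rewrite -[leLHS]mul1r ler_pdivrMr // mulrC.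
  exact: max_margin_row_norm.
have min_gt0 : 0 < min_row_norm X by rewrite (lt_le_trans _ min_ge) ?invr_gt0.
have : l2norm (row j W0) <= Num.sqrt alpha * l2norm wstar / m%:R.
  apply: (le_trans (W0_le j)); apply: (le_trans lambda_le).
  rewrite invfM -mulrA ler_wpM2l ?sqrtr_ge0 // mulrC ler_wpM2r ?invr_ge0 ?ler0n //.
  by rewrite -[leRHS]invrK lef_pV2 ?posrE ?invr_gt0.
rewrite -sqr_l2norm_row -(@ler_pXn2r _ 2) ?nnegrE ?l2norm_ge0 //; last first.
  by rewrite divr_ge0 ?mulr_ge0 ?sqrtr_ge0 ?l2norm_ge0.
by rewrite !exprMn [Num.sqrt alpha ^+ 2]sqr_sqrtr
  ?(ltW alpha_gt0) // exprVn.
Qed.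

(** Taken with [k] the number of violators, this makes the second-order term of a step linear in [k]
    instead of quadratic. *)
Lemma step_size_le k : (k <= n)%N ->
  eta * (m%:R * k%:R * max_row_norm X ^+ 2) <= 1.
Proof.
move=> k_le; have [_ eta_le] := eta_ok.
have max_gt0 : 0 < max_row_norm X.
  apply: (lt_le_trans _ (row_norm_le_max X (Ordinal n_gt0))).
  rewrite lt_def l2norm_ge0 andbT; apply/eqP => x0.
  by have := max_margin_row_norm (Ordinal n_gt0); rewrite x0 mulr0 ler10.
have D_gt0 : 0 < m%:R * n%:R * max_row_norm X ^+ 2.
  by rewrite !mulr_gt0 ?ltr0n ?exprn_gt0.
apply: le_trans (_ : eta * (m%:R * n%:R * max_row_norm X ^+ 2) <= _); last first.
  by rewrite -ler_pdivlMr.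
by rewrite ler_pM2l // ler_wpM2r ?sqr_ge0 // ler_wpM2l ?ler0n // ler_nat.
Qed.

Lemma gd_stepE W j : row j (gd_step alpha eta X y W) =
  row j W + (eta * unit_sign R j) *: \sum_(i | violators W i)
    (y i * leaky_relu_subgrad alpha (dot (row j W) (row i X))) *: row i X.
Proof. by rewrite /gd_step rowK. Qed.

(** The sign in the update of unit [j] cancels the one in [alignment], so each violator adds to each
    of the [2 m] units [eta] times a slope, at least [alpha], times a margin, at least 1. *)
Lemma alignment_gd_step W :
  alignment W + 2 * m%:R * alpha * eta * #|violators W|%:R
  <= alignment (gd_step alpha eta X y W).
Proof.
rewrite /alignment.
under [leRHS]eq_bigr do rewrite gd_stepE dotDl dotZl mulrDr mulrA mulrCA
  unit_sign_sqr mulr1.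
rewrite big_split lerD2l -mulr_sumr -!mulrA mulrCA [2 * _]mulrCA.
rewrite (_ : m%:R * _
  = eta * (\sum_(j < m.*2) alpha * #|violators W|%:R)); last first.
  by rewrite sum_const_units; ring.
rewrite ler_pM2l //; apply: ler_sum => j _; rewrite dot_suml mulrC -sum_const_card.
apply: ler_sum => i _; rewrite dotZl (dotC _ wstar) mulrAC.
have s_ge := subgrad_ge alpha_le1 (dot (row j W) (row i X)).
by rewrite (le_trans s_ge) // ler_peMl ?wstar_margin // (le_trans (ltW alpha_gt0)).
Qed.

(** Expand the square: the cross term and the second-order term each contribute at most
    [2 * eta * k]. *)
Lemma sqr_l2norm_gd_step W : l2norm (gd_step alpha eta X y W) ^+ 2
  <= l2norm W ^+ 2 + 4 * eta * #|violators W|%:R.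
Proof.
set k := #|violators W|; set M2 := max_row_norm X ^+ 2.
pose g j := \sum_(i | violators W i)
  (y i * leaky_relu_subgrad alpha (dot (row j W) (row i X))) *: row i X.
have kn : (k <= n)%N by rewrite -[n in leqRHS]card_ord max_card.
have g_le j : dot (g j) (g j) <= k%:R ^+ 2 * M2.
  apply: dot_sum_le => i _; rewrite dotZl dotZr -sqr_l2norm_row.
  set s := leaky_relu_subgrad _ _; set x := l2norm (row i X).
  have -> : y i * s * (y i * s * x ^+ 2) = y i * y i * (s * x) ^+ 2 by ring.
  rewrite sqr_label mul1r ler_pXn2r ?nnegrE //.
  - rewrite (le_trans _ (row_norm_le_max X i)) //.
    by rewrite ler_piMl ?l2norm_ge0 ?subgrad_le1.
  - by rewrite mulr_ge0 ?l2norm_ge0 // (le_trans (ltW alpha_gt0)) ?subgrad_ge.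
  - by rewrite (le_trans (l2norm_ge0 (row i X))) ?row_norm_le_max.
(* By homogeneity, exchanging the sums turns the left side into the sum of
   [y i * network alpha W (row i X)] over the violators, each term being below 1. *)
have cross : \sum_(j < m.*2) unit_sign R j * dot (row j W) (g j) <= k%:R.
  under eq_bigr do rewrite dot_sumr mulr_sumr.
  rewrite exchange_big -[k%:R]mulr1 -sum_const_card; apply: ler_sum => i /ltW.
  apply: le_trans; rewrite /network mulr_sumr; apply: ler_sum => j _.
  by rewrite dotZr -subgradM //; lra.
have -> : l2norm (gd_step alpha eta X y W) ^+ 2 = l2norm W ^+ 2
    + 2 * eta * (\sum_(j < m.*2) unit_sign R j * dot (row j W) (g j))
    + eta ^+ 2 * (\sum_(j < m.*2) dot (g j) (g j)).
  rewrite !sqr_l2norm !mulr_sumr -!big_split /=; apply: eq_bigr => j _.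
  rewrite gd_stepE -/(g j) !(dotDl, dotDr, dotZl, dotZr) (dotC (g j)).
  rewrite [X in _ + (_ + X)](_ : _ = eta ^+ 2 * (unit_sign R j * unit_sign R j)
    * dot (g j) (g j)); last by ring.
  by rewrite unit_sign_sqr mulr1; ring.
have quad : \sum_(j < m.*2) dot (g j) (g j) <= 2 * m%:R * (k%:R ^+ 2 * M2).
  apply: le_trans (ler_sum _ (fun j _ => g_le j)) _.
  by rewrite sum_const_units.
have : eta ^+ 2 * (2 * m%:R * (k%:R ^+ 2 * M2)) <= 2 * eta * k%:R.
  have -> : eta ^+ 2 * (2 * m%:R * (k%:R ^+ 2 * M2))
    = 2 * eta * k%:R * (eta * (m%:R * k%:R * M2)) by ring.
  by rewrite ler_piMr ?step_size_le // !mulr_ge0 ?ler0n // ltW.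
have : eta ^+ 2 * (\sum_(j < m.*2) dot (g j) (g j))
    <= eta ^+ 2 * (2 * m%:R * (k%:R ^+ 2 * M2)) by rewrite ler_wpM2l ?sqr_ge0.
have : 2 * eta * (\sum_(j < m.*2) unit_sign R j * dot (row j W) (g j))
    <= 2 * eta * k%:R by rewrite ler_wpM2l // mulr_ge0 ?ler0n // ltW.
lra.
Qed.

(** Young's inequality is applied row by row against [wstar] with the sign of the unit; the extra
    factor [s], equal to 1 or -1, yields the absolute value. *)
Lemma alignment_young (c : R) W : 0 < c ->
  2 * `|alignment W| <= c * l2norm W ^+ 2 + c^-1 * (2 * m%:R * l2norm wstar ^+ 2).
Proof.
move=> c0.
have young s : s * s = 1 -> 2 * (s * alignment W)
    <= c * l2norm W ^+ 2 + c^-1 * (2 * m%:R * l2norm wstar ^+ 2).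
  move=> ss.
  have -> : 2 * m%:R * l2norm wstar ^+ 2 = \sum_(j < m.*2) dot wstar wstar.
    by rewrite sum_const_units sqr_l2norm_row.
  rewrite sqr_l2norm /alignment 4!mulr_sumr -big_split /=; apply: ler_sum => j _.
  have := dot_young (row j W) ((s * unit_sign R j) *: wstar) c0.
  rewrite !dotZr dotZl [X in c^-1 * X](_ : _ = dot wstar wstar).
    by rewrite (mulrA s).
  by rewrite mulrA mulrACA ss unit_sign_sqr !mul1r.
have [h|h] := ler0P (alignment W).
  by rewrite -mulN1r young // mulrNN mulr1.
by rewrite -[alignment W]mul1r young // mulr1.
Qed.

(** * Bounds along a whole run and finite termination *)

Section Run.
Variables (lambda : R) (W0 : 'M[R]_(m.*2, d)).
Hypothesis W0_ok : init_ok alpha X lambda W0.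

Let W t := gd alpha eta X y W0 t.

Let progress t := eta * \sum_(s < t) #|violators (W s)|%:R.

Lemma init_norm : l2norm W0 ^+ 2 <= 2 * alpha * l2norm wstar ^+ 2 / m%:R.
Proof.
rewrite sqr_l2norm.
apply: le_trans (ler_sum _ (fun j _ => init_row_norm W0_ok j)) _.
rewrite sum_const_units le_eqVlt.
by apply/orP; left; apply/eqP; field; rewrite pnatr_eq0 -lt0n.
Qed.

Lemma alignment_gd t :
  alignment W0 + 2 * m%:R * alpha * progress t <= alignment (W t).
Proof.
elim: t => [|t IH]; first by rewrite /progress big_ord0 !mulr0 addr0.
have := alignment_gd_step (W t); rewrite -/(W t.+1).
by move: IH; rewrite /progress big_ord_recr /=; lra.
Qed.

Lemma sqr_l2norm_gd t : l2norm (W t) ^+ 2 <= l2norm W0 ^+ 2 + 4 * progress t.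
Proof.
elim: t => [|t IH]; first by rewrite /progress big_ord0 !mulr0 addr0.
have := sqr_l2norm_gd_step (W t); rewrite -/(W t.+1).
by move: IH; rewrite /progress big_ord_recr /=; lra.
Qed.

Lemma progress_le t :
  progress t <= 9 / 2 * l2norm wstar ^+ 2 / (m%:R * alpha ^+ 2).
Proof.
have m0 : (0 : R) < m%:R by rewrite ltr0n.
(* With this weight in Young's inequality, [|W t|^2] costs only half of the
   alignment gained. *)
have ma0 : 0 < m%:R * alpha / 2 by rewrite divr_gt0 ?mulr_gt0.
have m_neq0 : m%:R != 0 :> R by rewrite gt_eqF.
have alpha_neq0 : alpha != 0 by rewrite gt_eqF.
set B := l2norm wstar ^+ 2; have B0 : 0 <= B by rewrite sqr_ge0.
have norm_t : m%:R * alpha / 2 * l2norm (W t) ^+ 2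
    <= alpha * (alpha * B) + 2 * m%:R * alpha * progress t.
  have -> : alpha * (alpha * B) + 2 * m%:R * alpha * progress t
    = m%:R * alpha / 2 * (2 * alpha * B / m%:R + 4 * progress t) by field.
  rewrite ler_pM2l //; apply: (le_trans (sqr_l2norm_gd t)).
  by rewrite lerD2r init_norm.
have norm_0 : m%:R * l2norm W0 ^+ 2 <= 2 * (alpha * B).
  have -> : 2 * (alpha * B) = m%:R * (2 * alpha * B / m%:R) by field.
  by rewrite ler_pM2l // init_norm.
have := alignment_young (W t) ma0; rewrite -/B.
have -> : (m%:R * alpha / 2)^-1 * (2 * m%:R * B) = 4 * (B / alpha).
  by field; rewrite alpha_neq0.
have := alignment_young W0 m0; rewrite -/B.
have -> : m%:R^-1 * (2 * m%:R * B) = 2 * B by field.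
have := ler_norm (alignment (W t)); have := ler_norm (- alignment W0).
rewrite normrN => a0 at_ young0 youngt; have grow := alignment_gd t.
have aB : alpha * B <= B by rewrite ler_piMl.
have aaB : alpha * (alpha * B) <= alpha * B.
  by rewrite ler_piMl // mulr_ge0 // ltW.
have Ba : B <= B / alpha by rewrite ler_pdivlMr // mulrC.
(* Twice the growth of the alignment is [4 m alpha progress], of which [norm_t] absorbs half. What
   remains is [4 B / alpha + alpha^2 B] at time [t] and [2 alpha B + 2 B] at time 0; each power of
   [alpha] is at most [1 / alpha], whence 9 = 4 + 1 + 2 + 2. *)
have : 2 * m%:R * alpha * progress t <= 9 * (B / alpha) by lra.
have -> : 9 / 2 * B / (m%:R * alpha ^+ 2) = (9 * (B / alpha)) / (2 * m%:R * alpha).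
  by field; rewrite alpha_neq0.
by rewrite ler_pdivlMr ?mulr_gt0 // mulrC.
Qed.

(** Every step with a violator adds at least [eta] to the bounded quantity [progress], so the first
    time without violators comes early enough. *)
Lemma violators_stop : exists2 T : nat,
  T%:R * eta <= 9 / 2 * l2norm wstar ^+ 2 / (m%:R * alpha ^+ 2) &
  violators (W T) =i pred0.
Proof.
set K := 9 / 2 * _ / _.
have run t : (forall s, (s < t)%N -> (0 < #|violators (W s)|)%N) ->
    t%:R * eta <= K.
  move=> viol; apply: le_trans (progress_le t); rewrite mulrC ler_pM2l //.
  rewrite -[t in leLHS]card_ord -[leLHS]mulr1 -sum_const_card.
  by apply: ler_sum => s _; rewrite -[leLHS]/(1%:R) ler_nat viol.
have [|T /eqP/card0_eq T0 T_min] := @ex_minnP (fun t => #|violators (W t)| == 0%N).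
  (* If violators never ran out, a number of steps exceeding [K / eta] would contradict [run]. *)
  apply: contrapT => /forallNP stop.
  have : (Num.bound (K / eta))%:R * eta <= K.
    by apply: run => s _; rewrite lt0n; apply/negP; exact: stop.
  apply/negP; rewrite -ltNge -ltr_pdivrMr //; apply: archi_boundP.
  apply: divr_ge0; last exact: ltW.
  by apply: le_trans (progress_le 0); rewrite /progress big_ord0 mulr0.
exists T => //; apply: run => s sT; rewrite lt0n; apply/negP => /T_min.
by rewrite leqNgt sT.
Qed.

(** With [K = |wstar|^2 / (m alpha^2)], the constant 5 serves both bounds: it exceeds 9/2 for the
    time, and [|W T|^2 <= 2 K + 4 * (9/2) K = 20 K <= 25 K] for the norm. *)
Lemma gd_converges : exists T : nat,
  [/\ T%:R <= 5 * l2norm wstar ^+ 2 / (eta * alpha ^+ 2 * m%:R),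
      forall t, (T <= t)%N -> W t = W T,
      forall i, 1 <= y i * network alpha (W T) (row i X)
    & l2norm (W T) <= 5 / (alpha * Num.sqrt m%:R) * l2norm wstar].
Proof.
have m0 : (0 : R) < m%:R by rewrite ltr0n.
have m_neq0 : m%:R != 0 :> R by rewrite gt_eqF.
have alpha_neq0 : alpha != 0 by rewrite gt_eqF.
have eta_neq0 : eta != 0 by rewrite gt_eqF.
set B := l2norm wstar ^+ 2; have B0 : 0 <= B by rewrite sqr_ge0.
pose K := B / (m%:R * alpha ^+ 2).
have K0 : 0 <= K by rewrite divr_ge0 // mulr_ge0 ?sqr_ge0 ?ltW.
have [T T_le WT] := violators_stop.
have noviol i : violators (W T) i = false by have := WT i; rewrite inE.
exists T; split.
- rewrite (_ : 5 * B / _ = 5 * K / eta); last first.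
    by rewrite /K; field; rewrite alpha_neq0 eta_neq0.
  by rewrite ler_pdivlMr //; move: T_le; rewrite -mulrA -/B -/K; lra.
(* Without violators the gradient sum is empty, so [W T] is a fixed point of the step. *)
- move=> t /subnK <-; elim: (t - T)%N => // s IH.
  rewrite addSn -[LHS]/(gd_step alpha eta X y (W (s + T)%N)) IH.
  by apply/row_matrixP => j; rewrite gd_stepE big_pred0 // scaler0 addr0.
- move=> i; rewrite leNgt; apply/negP => viol.
  by have := noviol i; rewrite /violators viol.
- rewrite -(@ler_pXn2r _ 2) ?nnegrE ?l2norm_ge0 //; last first.
    by rewrite mulr_ge0 ?l2norm_ge0 // divr_ge0 // mulr_ge0 ?sqrtr_ge0 ?ltW.
  rewrite exprMn exprMn exprVn exprMn [Num.sqrt m%:R ^+ 2]sqr_sqrtr ?ler0n //.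
  rewrite (_ : 5 ^+ 2 / _ * _ = 25 * K); last first.
    by rewrite /K /B; field; rewrite alpha_neq0.
  apply: (le_trans (sqr_l2norm_gd T)).
  have := progress_le T; rewrite -mulrA -/B -/K.
  have : l2norm W0 ^+ 2 <= 2 * K.
    apply: (le_trans init_norm); rewrite -/B.
    have -> : 2 * alpha * B / m%:R = 2 * (alpha ^+ 3 * K).
      by rewrite /K; field; rewrite m_neq0 alpha_neq0.
    by rewrite ler_pM2l // ler_piMl // exprn_ile1 // ltW.
  lra.
Qed.

End Run.
End GradientDescent.

(** * Eventual values and the assembled theorem *)

Lemma final_iterateE (T : choiceType) (W : nat -> T) N :
  (forall t, (N <= t)%N -> W t = W N) -> final_iterate W = W N.
Proof.
(* The value chosen by [xget] has its own threshold [N']; comparing at [maxn N N'] shows that it is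
   [W N]. *)
move=> W_const; rewrite /final_iterate; case: xgetP => [V _ [N' V_const]|none].
  by rewrite -(V_const (maxn N N')) ?leq_maxr // W_const ?leq_maxl.
by case: (none (W N)); exists N.
Qed.

Theorem theorem3p1 (R : realType) :
  exists C : R, 0 < C /\
  forall (m d : nat) (alpha : R),
    (0 < m)%N -> (0 < d)%N -> 0 < alpha -> alpha <= 1 ->
    (forall (n : nat) (X : 'M[R]_(n, d)) (y : 'I_n -> R) (wstar : 'rV[R]_d)
        (eta lambda : R) (W0 : 'M[R]_(m.*2, d)),
      (0 < n)%N -> is_labeling y ->
      linearly_separable X y -> is_max_margin X y wstar ->
      step_size_ok m X eta -> init_ok alpha X lambda W0 ->
      exists T : nat,
        [/\ T%:R <= C * l2norm wstar ^+ 2 / (eta * alpha ^+ 2 * m%:R),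
            forall t, (T <= t)%N ->
              gd alpha eta X y W0 t = gd alpha eta X y W0 T,
            forall i,
              1 <= y i * network alpha (gd alpha eta X y W0 T) (row i X)
          & l2norm (gd alpha eta X y W0 T)
              <= C / (alpha * Num.sqrt m%:R) * l2norm wstar])
    /\
    (forall (eta : forall n : nat, 'M[R]_(n, d) -> ('I_n -> R) -> R)
        (W0 : algorithm R m d),
      (forall (n : nat) (X : 'M[R]_(n, d)) (y : 'I_n -> R),
        (0 < n)%N -> is_labeling y -> linearly_separable X y ->
        step_size_ok m X (eta n X y) /\
        exists lambda : R, init_ok alpha X lambda (W0 n X y)) ->
      approx_margin_maximizing alpha (gd_algorithm alpha eta W0)
        (C / (alpha * Num.sqrt m%:R)) /\
      (margin_factor alpha (gd_algorithm alpha eta W0)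
        <= (C / (alpha * Num.sqrt m%:R))%:E)%E).
Proof.
exists 5; split => // m d alpha m_gt0 d_gt0 alpha_gt0 alpha_le1; split.
  move=> n X y wstar eta lambda W0 n_gt0 y_label _ [wstar_margin _] eta_ok W0_ok.
  by have := gd_converges m_gt0 n_gt0 alpha_gt0 alpha_le1 y_label wstar_margin
    eta_ok W0_ok.
move=> eta W0 params_ok.
have maximizing : approx_margin_maximizing alpha (gd_algorithm alpha eta W0)
    (5 / (alpha * Num.sqrt m%:R)).
  split=> [|n X y wstar n_gt0 y_label X_sep [wstar_margin _]].
    by rewrite divr_gt0 // mulr_gt0 // sqrtr_gt0 ltr0n.
  have [eta_ok [lambda W0_ok]] := params_ok n X y n_gt0 y_label X_sep.
  have [T [_ W_const margin norm]] := gd_converges m_gt0 n_gt0 alpha_gt0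
    alpha_le1 y_label wstar_margin eta_ok W0_ok.
  by rewrite /gd_algorithm (final_iterateE W_const).
by split=> //; apply: ereal_inf_lbound; exists (5 / (alpha * Num.sqrt m%:R)).
Qed.
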